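(* Let $n\ge 1$, $b,c\in\mathbb{R}^n$, $a\in\mathbb{R}$, $r,R\in\mathbb{R}_+$, and $$\mathcal{F}:=\{x\in\mathbb{R}^n:\ r\le\|x\|\le R,\ \|x-c\|\le b^Tx-a\}.$$ Let $\rho\in[0,\|c\|]$ be such that $r\,c^Tx\le\rho\,x^Tx$ for all $x\in\mathcal{F}$. Let $q(x):=x^TH_qx+2g_q^Tx+f_q$ and $l(x):=2g_l^Tx+f_l$ (with $H_q\in\mathbb{R}^{n\times n}$, $g_q,g_l\in\mathbb{R}^n$, $f_q,f_l\in\mathbb{R}$) satisfy $q(x)\ge0$ and $l(x)\ge0$ for all $x\in\mathcal{F}$. Let $\kappa\ge0$ be a lower bound on $q(x)+l(x)$ over $\mathcal{F}$, i.e. $q(x)+l(x)\ge\kappa$ for all $x\in\mathcal{F}$. Then the linear inequality $$\begin{aligned}(r+R)R&\left(H_q\bullet X+2g_q^Tx+f_q\right)+(r+R)\left(2\,g_lb^T\bullet X+(f_lb-2ag_l)^Tx-af_l\right)\\ &\ge\ \kappa\,\mathrm{tr}(X)+rR\left(H_q\bullet X+2(g_q+g_l)^Tx+(f_q+f_l)\right)\\ &\qquad-\left(2\,g_lc^T\bullet X+f_lc^Tx\right)-\rho R\left(2g_l^Tx+f_l\right)\end{aligned}$$ holds for every $(x,X)\in\mathcal{G}$, where $\mathcal{G}$ is the closed convex hull of $\{(x,xx^T):x\in\mathcal{F}\}$.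
   Context: $\|\cdot\|$ is the Euclidean norm. $M\bullet X:=\mathrm{tr}(M^TX)$ is the trace inner product of matrices. The pairs $(x,X)$ have $x\in\mathbb{R}^n$ and $X$ a symmetric $n\times n$ real matrix. $\mathcal{G}:=\overline{\mathrm{conv}}\{(x,xx^T):x\in\mathcal{F}\}$ (since $\mathcal{F}$ is compact, the convex hull is already closed). *)

(* Defs.v *)
From HB Require Import structures.
From mathcomp Require Import all_boot all_order all_algebra.
From mathcomp Require Import all_classical all_reals all_analysis.

Set Implicit Arguments.
Unset Strict Implicit.
Unset Printing Implicit Defensive.

Import Order.TTheory GRing.Theory Num.Theory.
Import numFieldNormedType.Exports.

Local Open Scope classical_set_scope.
Local Open Scope ring_scope.

Definition dot (R : realType) (n : nat) (u v : 'cV[R]_n) : R :=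
  (u^T *m v) 0 0.

(* The library norm [`|x|] on matrices is the max norm, hence this one. *)
Definition enorm (R : realType) (n : nat) (x : 'cV[R]_n) : R :=
  Num.sqrt (dot x x).

Definition mxinner (R : realType) (m n : nat) (M X : 'M[R]_(m, n)) : R :=
  \tr (M^T *m X).

Definition quad_fun (R : realType) (n : nat)
    (H : 'M[R]_n) (g : 'cV[R]_n) (f : R) (x : 'cV[R]_n) : R :=
  dot x (H *m x) + 2 * dot g x + f.

Definition aff_fun (R : realType) (n : nat)
    (g : 'cV[R]_n) (f : R) (x : 'cV[R]_n) : R :=
  2 * dot g x + f.

Definition feasible (R : realType) (n : nat)
    (b c : 'cV[R]_n) (a rlo rhi : R) : set 'cV[R]_n :=
  [set x | rlo <= enorm x <= rhi /\ enorm (x - c) <= dot b x - a].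

Definition convex_hull (R : realType) (E : lmodType R) (A : set E) : set E :=
  smallest (fun B : set E => convex_set (B : set (convex_lmodType E))) A.

(* The closure is taken among all pairs of a vector and a square matrix; since
   the symmetric matrices form a closed subspace, it consists of pairs with a
   symmetric second component. *)
Definition lifted_hull (R : realType) (n : nat) (F : set 'cV[R]_n) :
    set ('cV[R]_n * 'M[R]_n) :=
  closure (convex_hull [set (x, x *m x^T) | x in F]).

(* Main.v *)
(* Both sides are affine in (x, X), and a closed half-space contains the closed
   convex hull as soon as it contains the generators (x, xx^T).  There, writing
   s = ||x||^2 and d = ||x - c||, replace b^T x - a by its lower bound d and
   kappa by its upper bound q + l.  As s <= R^2, it remains to see
   s + rR <= (r+R) d + c^T x + rho R.  Multiply by s and bound rho s below by
   r c^T x; since |s - c^T x| <= ||x|| d by Cauchy-Schwarz, this reduces to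
   |s - c^T x| (||x|| - r) (||x|| - R) <= 0. *)
Require Import Defs.
From HB Require Import structures.
From mathcomp Require Import all_boot all_order all_algebra.
From mathcomp Require Import all_classical all_reals all_analysis.
From mathcomp Require Import ring lra.

Set Implicit Arguments.
Unset Strict Implicit.
Unset Printing Implicit Defensive.

Import Order.TTheory GRing.Theory Num.Theory.
Import numFieldNormedType.Exports.

Local Open Scope classical_set_scope.
Local Open Scope ring_scope.

Lemma mxinnerE (R : realType) (m n : nat) (A X : 'M[R]_(m, n)) :
  mxinner A X = \sum_j \sum_i A i j * X i j.
Proof.
by apply: eq_bigr => j _; rewrite mxE; apply: eq_bigr => i _; rewrite mxE.
Qed.

Lemma dot_mxinner (R : realType) (n : nat) (u v : 'cV[R]_n) :
  dot u v = mxinner u v.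
Proof. by rewrite /dot /mxinner trace_mx11. Qed.

Lemma mxinnerDr (R : realType) (m n : nat) (A X Y : 'M[R]_(m, n)) :
  mxinner A (X + Y) = mxinner A X + mxinner A Y.
Proof. by rewrite /mxinner mulmxDr mxtraceD. Qed.

Lemma mxinnerZr (R : realType) (m n : nat) (k : R) (A X : 'M[R]_(m, n)) :
  mxinner A (k *: X) = k * mxinner A X.
Proof. by rewrite /mxinner -scalemxAr mxtraceZ. Qed.

Lemma mxinnerDl (R : realType) (m n : nat) (A B X : 'M[R]_(m, n)) :
  mxinner (A + B) X = mxinner A X + mxinner B X.
Proof. by rewrite /mxinner linearD /= mulmxDl mxtraceD. Qed.

Lemma mxinnerZl (R : realType) (m n : nat) (k : R) (A X : 'M[R]_(m, n)) :
  mxinner (k *: A) X = k * mxinner A X.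
Proof. by rewrite /mxinner linearZ /= -scalemxAl mxtraceZ. Qed.

Lemma mxinnerNl (R : realType) (m n : nat) (A X : 'M[R]_(m, n)) :
  mxinner (- A) X = - mxinner A X.
Proof. by rewrite -scaleN1r mxinnerZl mulN1r. Qed.

Lemma mxinner_scalar (R : realType) (n : nat) (k : R) (X : 'M[R]_n) :
  mxinner k%:M X = k * \tr X.
Proof. by rewrite /mxinner tr_scalar_mx mul_scalar_mx mxtraceZ. Qed.

(** Cyclicity of the trace leaves the 1x1 matrix x^T A^T x, which equals its own transpose. *)
Lemma mxinner_outer (R : realType) (n : nat) (A : 'M[R]_n) (x : 'cV[R]_n) :
  mxinner A (x *m x^T) = dot x (A *m x).
Proof.
rewrite /mxinner /dot mulmxA mxtrace_mulC trace_mx11.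
by rewrite -[in RHS](trmxK (x^T *m _)) [RHS]mxE !trmx_mul trmxK mulmxA.
Qed.

Lemma dotC (R : realType) (n : nat) (u v : 'cV[R]_n) : dot u v = dot v u.
Proof.
by rewrite !dot_mxinner /mxinner -[RHS]mxtrace_tr trmx_mul trmxK.
Qed.

Lemma dotBr (R : realType) (n : nat) (u v w : 'cV[R]_n) :
  dot u (v - w) = dot u v - dot u w.
Proof. by rewrite !dot_mxinner mxinnerDr -scaleN1r mxinnerZr mulN1r. Qed.

Lemma dotZr (R : realType) (n : nat) (k : R) (u v : 'cV[R]_n) :
  dot u (k *: v) = k * dot u v.
Proof. by rewrite !dot_mxinner mxinnerZr. Qed.

(** Serves to recognise the rank-one terms in [gl *m b^T] and [gl *m c^T] as products of two linear
    forms once X = xx^T. *)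
Lemma dot_mul_outer (R : realType) (n : nat) (x u v : 'cV[R]_n) :
  dot x (u *m v^T *m x) = dot u x * dot v x.
Proof.
by rewrite /dot -mulmxA mulmxA mxE big_ord1 -/(dot x u) dotC.
Qed.

Lemma dotxx_ge0 (R : realType) (n : nat) (x : 'cV[R]_n) : 0 <= dot x x.
Proof.
rewrite /dot mxE; apply: sumr_ge0 => i _.
by rewrite mxE -expr2 sqr_ge0.
Qed.

Lemma dotxx_eq0 (R : realType) (n : nat) (x : 'cV[R]_n) :
  dot x x = 0 -> x = 0.
Proof.
rewrite /dot mxE => /eqP; rewrite psumr_eq0 => [/allP x0|i _]; last first.
  by rewrite mxE -expr2 sqr_ge0.
apply/colP => i; rewrite mxE; apply/eqP.
by have := x0 i (mem_index_enum i); rewrite mxE -expr2 sqrf_eq0.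
Qed.

Lemma enorm_sqr (R : realType) (n : nat) (x : 'cV[R]_n) :
  enorm x ^+ 2 = dot x x.
Proof. by rewrite sqr_sqrtr // dotxx_ge0. Qed.

Lemma dot_sqr_le (R : realType) (n : nat) (x y : 'cV[R]_n) :
  dot x y ^+ 2 <= dot x x * dot y y.
Proof.
have [y0|yn0] := eqVneq (dot y y) 0.
  by rewrite y0 mulr0 (dotxx_eq0 y0) /dot mulmx0 mxE expr0n.
have ygt0 : 0 < dot y y by rewrite lt_def yn0 dotxx_ge0.
(* This vector is y.y times the component of x orthogonal to y; its squared norm is y.y times the
   gap in the Cauchy-Schwarz inequality. *)
have := dotxx_ge0 (dot y y *: x - dot x y *: y).
rewrite dotBr !dotZr ![dot (_ - _) _]dotC !dotBr !dotZr [dot y x]dotC => h.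
rewrite -subr_ge0 -(pmulr_rge0 _ ygt0).
apply: le_trans h _; rewrite le_eqVlt; apply/orP; left; apply/eqP.
by ring.
Qed.

Lemma mxinner_continuous (R : realType) (m n : nat) (A : 'M[R]_(m, n)) :
  continuous (mxinner A).
Proof.
rewrite (_ : mxinner A = fun X => \sum_j \sum_i A i j * X i j); last first.
  by apply/funext => X; rewrite mxinnerE.
apply: continuous_big => [|j _]; first exact: add_continuous.
apply: continuous_big => [|i _ X]; first exact: add_continuous.
by apply: continuousM; [exact: cst_continuous|exact: coord_continuous].
Qed.

Lemma lifted_hull_affine_ge0 (R : realType) (n : nat) (F : set 'cV[R]_n)
    (A : 'M[R]_n) (g : 'cV[R]_n) (k : R) :
  (forall x, F x -> 0 <= mxinner A (x *m x^T) + dot g x + k) ->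
  forall x X, lifted_hull F (x, X) -> 0 <= mxinner A X + dot g x + k.
Proof.
move=> FP x X.
(* With [dot g] written as [mxinner g], the same continuity and linearity lemmas serve both
   components. *)
pose f (p : 'cV[R]_n * 'M[R]_n) : R := mxinner A p.2 + mxinner g p.1 + k.
have f_cont : continuous f.
  move=> p; apply: cvgD; last exact: cvg_cst.
  apply: cvgD.
    exact: (continuous_comp (@cvg_snd _ _ _ _ _) (@mxinner_continuous _ _ _ A _)).
  exact: (continuous_comp (@cvg_fst _ _ _ _ _) (@mxinner_continuous _ _ _ g _)).
have clf : closed [set p | 0 <= f p].
  by apply: (@preimage_closed _ _ f [set y | 0 <= y]) => [p _|];
    [exact: f_cont|exact: closed_ge].
suff sub : lifted_hull F `<=` [set p | 0 <= f p].
  by move=> /sub; rewrite /f /= dot_mxinner.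
rewrite (closure_id [set p | 0 <= f p]).1 //; apply: closureS.
apply: smallest_sub => [p q l|_ [y Fy <-]]; last first.
  by rewrite /f /= -dot_mxinner FP.
rewrite !inE /= => fp fq.
have l0 : 0 <= l%:num :> R by [].
have l1 : l%:num <= 1 :> R by [].
rewrite /conv /= /f /= !mxinnerDr !mxinnerZr.
(* The constant [k] splits because the two weights sum to 1. *)
rewrite (_ : _ + k = l%:num * f p + (1 - l%:num) * f q); last first.
  by rewrite /f /unstable.onem; ring.
by rewrite addr_ge0 ?mulr_ge0 ?subr_ge0.
Qed.

(** Scalar core of the argument, meant for t = ||x||, d = ||x - c|| and u = c^T x; the last
    hypothesis is then Cauchy-Schwarz for x and x - c. *)
Lemma shell_ineq (R : realType) (t d u rlo rhi rho : R) :
  0 <= rlo -> rlo <= t -> t <= rhi -> 0 <= rho -> 0 <= d ->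
  rlo * u <= rho * t ^+ 2 -> (t ^+ 2 - u) ^+ 2 <= t ^+ 2 * d ^+ 2 ->
  t ^+ 2 + rlo * rhi <= (rlo + rhi) * d + u + rho * rhi.
Proof.
move=> rlo0 rlot trhi rho0 d0 rhou cs.
have t0 : 0 <= t by exact: le_trans rlot.
have rhi0 : 0 <= rhi by exact: le_trans trhi.
(* The main argument divides by t^2. At t = 0 the hypotheses force u = 0 and [rlo] = 0. *)
have [t_eq0|tn0] := eqVneq t 0.
  move: cs; rewrite t_eq0 expr0n mul0r sub0r sqrrN => u2.
  have /eqP -> : u == 0 by rewrite -sqrf_eq0 eq_le u2 sqr_ge0.
  have -> : rlo = 0 by apply/eqP; rewrite eq_le rlo0 -t_eq0 rlot.
  by rewrite !(mul0r, add0r, addr0) addr_ge0 // mulr_ge0.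
have tgt0 : 0 < t by rewrite lt_def tn0.
have wtd : `|t ^+ 2 - u| <= t * d.
  by rewrite -(ger0_norm (mulr_ge0 t0 d0)) -ler_sqr ?nnegrE // !real_normK
    ?num_real // exprMn.
have w_le := ler_norm (t ^+ 2 - u).
have w_ge0 := normr_ge0 (t ^+ 2 - u).
move: (`|t ^+ 2 - u|) wtd w_le w_ge0 => w wtd w_le w_ge0.
rewrite -subr_ge0 -(pmulr_rge0 _ (exprn_gt0 2 tgt0)).
(* The four products add up to t^2 times the desired difference: with w standing for |t^2 - u|, all
   terms in w cancel. *)
have h1 : 0 <= (rlo + rhi) * t * (t * d - w).
  by rewrite mulr_ge0 ?subr_ge0 // mulr_ge0 // addr_ge0.
have h2 : 0 <= rhi * (rho * t ^+ 2 - rlo * u) by rewrite mulr_ge0 ?subr_ge0.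
have h3 : 0 <= (t ^+ 2 + rlo * rhi) * (w - (t ^+ 2 - u)).
  by rewrite mulr_ge0 ?subr_ge0 // addr_ge0 ?sqr_ge0 // mulr_ge0.
have h4 : 0 <= w * ((t - rlo) * (rhi - t)).
  by rewrite mulr_ge0 // mulr_ge0 // subr_ge0.
have := addr_ge0 (addr_ge0 h1 h2) (addr_ge0 h3 h4).
by congr (_ <= _); ring.
Qed.

Theorem theorem1 (R : realType) (n : nat) (n_ge1 : (1 <= n)%N)
    (b c : 'cV[R]_n) (a rlo rhi : R) (rlo_ge0 : 0 <= rlo) (rhi_ge0 : 0 <= rhi)
    (rho : R) (rho_bounds : 0 <= rho <= enorm c)
    (rhoP : forall x, feasible b c a rlo rhi x ->
              rlo * dot c x <= rho * dot x x)
    (Hq : 'M[R]_n) (gq gl : 'cV[R]_n) (fq fl : R)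
    (q_ge0 : forall x, feasible b c a rlo rhi x -> 0 <= quad_fun Hq gq fq x)
    (l_ge0 : forall x, feasible b c a rlo rhi x -> 0 <= aff_fun gl fl x)
    (kappa : R) (kappa_ge0 : 0 <= kappa)
    (kappaP : forall x, feasible b c a rlo rhi x ->
                kappa <= quad_fun Hq gq fq x + aff_fun gl fl x) :
  forall (x : 'cV[R]_n) (X : 'M[R]_n),
    lifted_hull (feasible b c a rlo rhi) (x, X) ->
    (rlo + rhi) * rhi * (mxinner Hq X + 2 * dot gq x + fq)
      + (rlo + rhi) * (mxinner (2 *: (gl *m b^T)) X
                       + dot (fl *: b - (2 * a) *: gl) x - a * fl)
    >= kappa * \tr X
       + rlo * rhi * (mxinner Hq X + 2 * dot (gq + gl) x + (fq + fl))
       - (mxinner (2 *: (gl *m c^T)) X + fl * dot c x)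
       - rho * rhi * (2 * dot gl x + fl).
Proof.
move=> x X xX; rewrite -subr_ge0.
(* [A], [g] and [k] collect the coefficients of left side minus right side; (r+R)R - rR = R^2 gives
   the factor of q, and kappa tr(X) enters as a multiple of the identity. *)
pose A := (rhi ^+ 2) *: Hq + (2 * (rlo + rhi)) *: (gl *m b^T)
  + 2 *: (gl *m c^T) + (- kappa)%:M.
pose g := (2 * rhi ^+ 2) *: gq
  + (rlo + rhi) *: (fl *: b - (2 * a) *: gl)
  + (- (2 * rlo * rhi) + 2 * rho * rhi) *: gl + fl *: c.
pose k := rhi ^+ 2 * fq - (rlo + rhi) * a * fl - rlo * rhi * fl
  + rho * rhi * fl.
suff Fge0 y : feasible b c a rlo rhi y ->
    0 <= mxinner A (y *m y^T) + dot g y + k.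
  have := lifted_hull_affine_ge0 Fge0 xX; congr (_ <= _).
  rewrite /A /g /k !dot_mxinner.
  by rewrite !(mxinnerDl, mxinnerNl, mxinnerZl, mxinner_scalar); ring.
move=> Fy; have [/andP[rlo_le le_rhi] dist_le] := Fy.
have rho0 : 0 <= rho by case/andP: rho_bounds.
have q0 := q_ge0 y Fy; have l0 := l_ge0 y Fy; have kq := kappaP y Fy.
have t0 : 0 <= enorm y by exact: sqrtr_ge0.
have d0 : 0 <= enorm (y - c) by exact: sqrtr_ge0.
have key : dot y y + rlo * rhi
    <= (rlo + rhi) * enorm (y - c) + dot c y + rho * rhi.
  (* Cauchy-Schwarz applies since y.y - c.y = y.(y - c). *)
  rewrite -enorm_sqr; apply: shell_ineq => //; rewrite !enorm_sqr ?rhoP //.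
  by rewrite [dot c y]dotC -dotBr dot_sqr_le.
have s_le : dot y y <= rhi ^+ 2 by rewrite -enorm_sqr ler_sqr ?nnegrE.
(* With s = y.y and d = ||y - c||, the target is the sum of l (r+R)(b^T y - a - d), l ((r+R)d + c^T
   y + rho R - s - rR), s (q + l - kappa) and q (R^2 - s); the terms in l d, l s and q s cancel. *)
have h1 := mulr_ge0 l0 (mulr_ge0 (addr_ge0 rlo_ge0 rhi_ge0)
  (eqbRL (subr_ge0 _ _) dist_le)).
have h2 := mulr_ge0 l0 (eqbRL (subr_ge0 _ _) key).
have h3 := mulr_ge0 (dotxx_ge0 y) (eqbRL (subr_ge0 _ _) kq).
have h4 := mulr_ge0 q0 (eqbRL (subr_ge0 _ _) s_le).
have := addr_ge0 (addr_ge0 h1 h2) (addr_ge0 h3 h4); congr (_ <= _).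
rewrite /A /g /k mxinnerDl mxinner_scalar !(mxinnerDl, mxinnerNl, mxinnerZl).
rewrite mxinner_outer !mxinner_outer !dot_mul_outer mxtrace_mulC trace_mx11.
rewrite -/(dot y y) !dot_mxinner !(mxinnerDl, mxinnerNl, mxinnerZl) -!dot_mxinner.
by rewrite /quad_fun /aff_fun; ring.
Qed.
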